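(* Let $\mu\in\mathcal{P}_T(\Theta)$ and $t\in\mathbb{R}$. (a) If $\mu(N_t)=0$, then $\gamma_t(\mu)>0$, i.e. $\gamma(\mu)>t$. (b) If $\mu(N_t)=1$, then $\gamma_t(\mu)\leqslant0$, i.e. $\gamma(\mu)\leqslant t$. If $\mu$ is ergodic, then both implications are equivalences and, furthermore, (c) $\mu(S_t)=1$ for $t=\gamma(\mu)$, and $\mu(S_t)=0$ otherwise.
   Context: $(\Theta,\mathcal{B})$ is a measurable space and $T:\Theta\to\Theta$ is bi-measurable (a measurable bijection with measurable inverse). $\mathcal{P}_T(\Theta)$ denotes the set of $T$-invariant probability measures on $(\Theta,\mathcal{B})$. Write $\mathbb{R}_\geqslant=[0,\infty)$. The function $h\in C^1(\mathbb{R}_\geqslant;\mathbb{R})$ is strictly concave with $h(0)=0$, $h'(x)>0$ for $x>0$, $h'(0)=1$ and $\lim_{x\to\infty}h(x)/x=0$. The function $g:\Theta\to(0,\infty)$ is bounded and measurable. For $t\in\mathbb{R}$ let $f_t(\theta,x)=e^{-t}g(\theta)h(x)$ on $\Theta\times\mathbb{R}_\geqslant$, and iterate: $f_t^0(\theta,x)=x$, $f_t^1=f_t$, $f_t^n(\theta,x)=f_t(T^{n-1}\theta,f_t^{n-1}(\theta,x))$. For each $t$ fix $M_t>0$ such that $f_t(\theta,M_t)<M_t$ for all $\theta\in\Theta$ (such $M_t$ exists). Put $\psi_{t,n}(\theta)=f_t^n(T^{-n}\theta,M_t)$ and define the maximal invariant function $$\varphi_t(\theta)=\lim_{n\to\infty}\psi_{t,n}(\theta)=\inf_n\psi_{t,n}(\theta).$$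 Set $N_t=\{\theta\in\Theta:\varphi_t(\theta)=0\}$. One has $N_t\subseteq N_s$ for $t<s$. Define $t_c(\theta)=\inf\{t\in\mathbb{R}:\varphi_t(\theta)=0\}$ and $S_t=\{\theta\in\Theta:t_c(\theta)=t\}$. For $\mu\in\mathcal{P}_T(\Theta)$ put $\gamma(\mu)=\int\log g\,d\mu$ (well defined, with values in $[-\infty,\infty)$, since $g$ is bounded), and let $$\gamma_t(\mu)=\int\log\left|\frac{d}{dx}f_t(\cdot,x)\Big|_{x=0}\right|d\mu=\gamma(\mu)-t$$ be the average fibre-wise Lyapunov exponent at the baseline. *)

(* Defs.v *)
From HB Require Import structures.
From mathcomp Require Export all_boot all_order all_algebra.
From mathcomp Require Export all_classical all_reals all_analysis.

Set Implicit Arguments.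
Unset Strict Implicit.
Unset Printing Implicit Defensive.

Import Order.TTheory GRing.Theory Num.Theory.
Import numFieldNormedType.Exports.

Local Open Scope classical_set_scope.
Local Open Scope ring_scope.

(* Functions on the half-line [0, +oo) are represented by functions R -> R of
   which only the values at nonnegative arguments matter.  Accordingly the
   derivative is the limit of difference quotients taken inside [0, +oo); it is
   the right derivative at 0 and the usual derivative at x > 0. *)
Section half_line.
Context {R : realType}.
Implicit Types (h : R -> R) (x : R).

Definition diff_quot_nneg h x :=
  (h y - h x) / (y - x) @[y --> within `[0, +oo[ x^'].

Definition derive_nneg h x : R := lim (diff_quot_nneg h x).

Definition C1_nneg h : Prop :=
  (forall x, 0 <= x -> cvg (diff_quot_nneg h x)) /\
  {within `[0, +oo[, continuous (derive_nneg h)}.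

Definition strictly_concave_nneg h : Prop :=
  forall x y l : R, 0 <= x -> 0 <= y -> x != y -> 0 < l < 1 ->
    l * h x + (1 - l) * h y < h (l * x + (1 - l) * y).

End half_line.

Section invariant_measures.
Context {d : measure_display} {Theta : measurableType d} {R : realType}.

Definition invariant_measure (T : Theta -> Theta) (mu : set Theta -> \bar R) :
    Prop :=
  forall A, measurable A -> mu (T @^-1` A) = mu A.

Definition ergodic (T : Theta -> Theta) (mu : set Theta -> \bar R) : Prop :=
  forall A, measurable A -> T @^-1` A = A -> mu A = 0%E \/ mu A = 1%E.

End invariant_measures.

Section skew_product.
Context {Theta : Type} {R : realType}.
Implicit Types (T Tinv : Theta -> Theta) (g : Theta -> R) (h M : R -> R).

Definition fibre_map g h (t : R) (theta : Theta) (x : R) : R :=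
  expR (- t) * g theta * h x.

Fixpoint fibre_iter T (f : Theta -> R -> R) (n : nat) (theta : Theta) (x : R) :
    R :=
  if n is m.+1 then f (iter m T theta) (fibre_iter T f m theta x) else x.

(* In what follows Tinv stands for the inverse of T, and M for t |-> M_t. *)
Definition upper_iter T Tinv g h M (t : R) (n : nat) (theta : Theta) : R :=
  fibre_iter T (fibre_map g h t) n (iter n Tinv theta) (M t).

Definition max_invariant T Tinv g h M (t : R) (theta : Theta) : R :=
  limn (fun n => upper_iter T Tinv g h M t n theta).

Definition zero_set T Tinv g h M (t : R) : set Theta :=
  [set theta | max_invariant T Tinv g h M t theta = 0].

(* Extended-real valued: the infimum is -oo at those theta for which
   max_invariant vanishes for every t. *)
Definition critical_parameter T Tinv g h M (theta : Theta) : \bar R :=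
  ereal_inf [set t%:E | t in
    [set t : R | max_invariant T Tinv g h M t theta = 0]].

Definition critical_set T Tinv g h M (t : R) : set Theta :=
  [set theta | critical_parameter T Tinv g h M theta = t%:E].

End skew_product.

Section lyapunov_exponents.
Context {d : measure_display} {Theta : measurableType d} {R : realType}.
Implicit Types (mu : probability Theta R) (g : Theta -> R) (h : R -> R).

Definition mean_log g mu : \bar R := (\int[mu]_theta (ln (g theta))%:E)%E.

Definition baseline_exponent g h (t : R) mu : \bar R :=
  (\int[mu]_theta (ln `|derive_nneg (fibre_map g h t theta) 0|)%:E)%E.

End lyapunov_exponents.

(* Main.v *)
(* Put [w = ln (e^-t g)], so that [gamma_t(mu)] is the integral of [w].

   (a) [phi := phi_t] is invariant, [phi (T x) = e^-t g(x) h(phi x)], hence where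
   [phi > 0] we have [w = (ln phi \o T - ln phi) + ln (phi / h phi)].  The last
   term is positive because [h y < y], and a coboundary [v \o T - v] bounded above
   with [v] bounded above has nonnegative integral (truncate [v], use Fatou).

   (b) Put [psi_n := psi_(t,n)]; then [psi_(n+1) (T x) = e^-t g(x) h(psi_n x)], and
   [psi_n] decreases in [n].  Taking logarithms and integrating,
   [int w <= int ln (psi_n / h psi_n)], and the right-hand side tends to [0] by
   dominated convergence when [psi_n] tends to [0] a.e., since [h'(0) = 1].

   As [w] is bounded above by a constant [C] but need not be integrable, both
   arguments are run with the nonnegative function [C - w].  The ergodic case
   follows because [N_t] is [T]-invariant and increasing in [t], and
   [S_t] is the set of points lying in every [N_s], [s > t], and in no [N_s],
   [s < t]. *)
Require Import Defs.
Import Order.TTheory GRing.Theory Num.Theory.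
Import numFieldNormedType.Exports.
From mathcomp Require Import measurable_realfun ring lra.
Local Open Scope classical_set_scope.
Local Open Scope ring_scope.

Set Implicit Arguments.
Unset Strict Implicit.

(** * Concave functions on the half-line *)

Section concave_half_line.
Context {R : realType}.
Implicit Types (h : R -> R) (x y l : R).

Lemma at_right_within_nneg x : 0 <= x -> x^'+ --> within `[0, +oo[ x^'.
Proof.
move=> x0 P; rewrite /= /within /dnbhs /at_right /within /= => xP.
apply: (@filterS _ (nbhs x) _ _ _ _ xP) => y /= yP xy; apply: yP; first by rewrite gt_eqF.
by rewrite in_itv/= andbT (le_trans x0)// ltW.
Qed.

Lemma cvg_diff_quot_right h x l : 0 <= x -> diff_quot_nneg h x --> l ->
  (h y - h x) / (y - x) @[y --> x^'+] --> l.
Proof.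
by move=> x0; apply: cvg_trans; apply: cvg_app; exact: at_right_within_nneg.
Qed.

(** Both limits are restricted to the right neighbourhoods [x^'+], where uniqueness of limits in a
    Hausdorff space applies, including at [x = 0]. *)
Lemma derive_nnegE h x l : 0 <= x -> diff_quot_nneg h x --> l ->
  derive_nneg h x = l.
Proof.
move=> x0 hl; have cvgh : cvg (diff_quot_nneg h x) by apply/cvg_ex; exists l.
have hr := cvg_diff_quot_right x0 cvgh.
have hr' := cvg_diff_quot_right x0 hl.
by apply: (@cvg_unique _ (@norm_hausdorff _ R) _ _ _ _ hr hr').
Qed.

Lemma derive_nnegZ h x (c : R) : 0 <= x -> cvg (diff_quot_nneg h x) ->
  derive_nneg (fun y => c * h y) x = c * derive_nneg h x.
Proof.
move=> x0 cvgh; apply: derive_nnegE => //; rewrite /diff_quot_nneg.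
under eq_fun do rewrite -mulrBr -mulrA.
exact: cvgMl_tmp.
Qed.

Variables (h : R -> R).
Hypothesis h_C1 : C1_nneg h.
Hypothesis h_concave : strictly_concave_nneg h.
Hypothesis h0 : h 0 = 0.

(** Strict concavity at [y = l x + (1 - l) z] with [l = (z - y) / (z - x)], cleared of denominators
    for use by [lra] and [nra]. *)
Lemma concave_three_points x y z : 0 <= x -> x < y -> y < z ->
  (z - y) * h x + (y - x) * h z < (z - x) * h y.
Proof.
move=> x0 xy yz.
have xz : 0 < z - x by lra.
have := @h_concave x z ((z - y) / (z - x)) x0 _ _ _.
rewrite (_ : 1 - _ = (y - x) / (z - x)); last by field; lra.
rewrite (_ : _ * x + _ = y); last by field; lra.
move=> H.
rewrite -(ltr_pM2l (x := (z - x)^-1)) ?invr_gt0//.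
rewrite [X in _ < X](_ : _ = h y); last by field; lra.
apply: le_lt_trans (H _ _ _); [|lra| | ].
- by rewrite le_eqVlt; apply/orP; left; apply/eqP; field; lra.
- by rewrite lt_eqF//; lra.
- by rewrite divr_gt0 ?ltr_pdivrMr//=; lra.
Qed.

(** The derivative is used at the right endpoint [y], which is positive even if [x = 0]: some
    [z > y] has [h y < h z], and by concavity the slope over [[x, y]] exceeds that over [[y, z]]. *)
Lemma concave_increasing x y : (forall x, 0 < x -> 0 < derive_nneg h x) ->
  0 <= x -> x < y -> h x < h y.
Proof.
move=> dh_gt0 x0 xy; have y0 : 0 < y by lra.
have := cvg_diff_quot_right (ltW y0) (h_C1.1 _ (ltW y0)).
move=> /(cvgr_gt (derive_nneg h y)) /(_ _ (dh_gt0 _ y0)) slope_gt0.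
near (y^'+) => z.
have yz : y < z by near: z; exact: nbhs_right_gt.
have : 0 < (h z - h y) / (z - y) by near: z.
rewrite pmulr_lgt0 ?invr_gt0 ?subr_gt0// => hyz.
have := concave_three_points x0 xy yz; nra.
Unshelve. all: by end_near. Qed.

(** Chord slopes [h x / x] from the origin strictly decrease, since [h 0 = 0]. *)
Lemma concave_star x y : 0 < x -> x < y -> h y * x < h x * y.
Proof.
move=> x0 xy; have := concave_three_points (lexx 0) x0 xy; rewrite h0; lra.
Qed.

Lemma concave_chord_cvg : derive_nneg h 0 = 1 -> h x / x @[x --> 0^'+] --> (1 : R).
Proof.
move=> dh0; have := cvg_diff_quot_right (lexx 0) (h_C1.1 _ (lexx 0)).
rewrite -dh0; apply: cvg_trans; apply: near_eq_cvg; near=> x.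
by rewrite h0 !subr0.
Unshelve. all: by end_near. Qed.

Lemma concave_lt_id x : derive_nneg h 0 = 1 -> 0 < x -> h x < x.
Proof.
move=> dh0 x0.
(* Letting a chord slope tend to [h'(0) = 1] gives only a weak bound. It is taken at [x / 2], and
   the strict decrease of slopes from [x / 2] to [x] makes it strict. *)
suff half1 : h (x / 2) / (x / 2) <= 1.
  have x20 : 0 < x / 2 by rewrite divr_gt0.
  move: half1; rewrite ler_pdivrMr// mul1r.
  have : x / 2 < x by lra.
  by move=> /(concave_star x20); nra.
apply: (cvgr_to_ge (concave_chord_cvg dh0)).
have x20 : 0 < x / 2 by rewrite divr_gt0.
near=> y.
have y0 : 0 < y by near: y; exact: nbhs_right_gt.
have yx : y < x / 2 by near: y; exact: nbhs_right_lt.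
by rewrite ler_pdivrMr// mulrAC ler_pdivlMr// ltW// concave_star.
Unshelve. all: by end_near. Qed.

End concave_half_line.

(** * Integrals of coboundaries *)

Section integrals.
Context {d : measure_display} {Theta : measurableType d} {R : realType}.
Variable mu : probability Theta R.
Implicit Types f v : Theta -> R.

Lemma integral_cst_probability (c : R) : (\int[mu]_x c%:E = c%:E)%E.
Proof. by rewrite integral_cst//= probability_setT mule1. Qed.

Lemma adde_cancelr (a b c : \bar R) : c \is a fin_num ->
  (a + c = b + c -> a = b)%E.
Proof.
by move=> cfin E; rewrite -[a](addeK a cfin) E addeK.
Qed.

(* Also true when [f] is not integrable, both sides being then [-oo]. *)
Lemma integral_bounded_above f (C : R) : measurable_fun setT f -> 0 <= C ->
  (forall x, f x <= C) ->
  (\int[mu]_x (f x)%:E = C%:E - \int[mu]_x (C - f x)%:E)%E.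
Proof.
move=> mf C0 fC.
have mEf : measurable_fun setT (EFin \o f) by exact/measurable_EFinP.
have mCf : measurable_fun setT (fun x => (C - f x)%:E).
  by apply/measurable_EFinP; exact: measurable_funB.
have fposC : ((\int[mu]_x (EFin \o f)^\+ x)%E \is a fin_num).
  rewrite ge0_fin_numE ?integral_ge0//.
  apply: (@le_lt_trans _ _ (\int[mu]_x (cst C%:E x))%E).
    apply: ge0_le_integral => //; first exact: measurable_funepos.
    by move=> x _; rewrite funeposE /= ge_max !lee_fin C0 fC.
  by rewrite integral_cst_probability ltry.
(* The pointwise identity [(C - f) + f^+ = C + f^-] has nonnegative terms only, so it integrates
   even when the integral of [f^-] is infinite. *)
have : (\int[mu]_x (C - f x)%:E + \int[mu]_x (EFin \o f)^\+ x =
        C%:E + \int[mu]_x (EFin \o f)^\- x)%E.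
  rewrite -ge0_integralD//; [|by move=> x _; rewrite lee_fin subr_ge0
    |exact: measurable_funepos].
  have -> : (C%:E = \int[mu]_x (cst C%:E x))%E.
    by rewrite integral_cst_probability.
  rewrite -ge0_integralD//; [|exact: measurable_funeneg].
  apply: eq_integral => x _; rewrite funeposE funenegE /= -!EFin_max -!EFinD.
  by congr (_%:E); case: (leP (f x) 0) => fx; case: (leP (- f x) 0) => fx'; lra.
have aux (P Q U : \bar R) : P \is a fin_num ->
    (U + P = C%:E + Q -> P - Q = C%:E - U)%E.
  case: P Q U => [p||] [q||] [u||]// _; rewrite -!EFinD => -[E].
  by congr EFin; lra.
by move=> E; rewrite [LHS]integralE; exact: aux E.
Qed.

Variable T : Theta -> Theta.
Hypothesis mT : measurable_fun setT T.
Hypothesis mu_inv : invariant_measure T mu.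

Lemma ge0_integral_invariant (f : Theta -> \bar R) : measurable_fun setT f ->
  (forall x, (0 <= f x)%E) -> (\int[mu]_x f (T x) = \int[mu]_x f x)%E.
Proof.
move=> mf f0.
transitivity (\int[pushforward mu T]_x f x)%E.
  by rewrite (ge0_integral_pushforward mT)// preimage_setT.
by apply: eq_measure_integral => A mA _; exact: mu_inv.
Qed.

(** Adding the finite integral of [v - a], which equals that of [v \o T - a] by invariance, cancels
    the coboundary and leaves only nonnegative integrands. *)
Lemma integral_bounded_coboundary v (a b C : R) : measurable_fun setT v ->
  (forall x, a <= v x <= b) -> (forall x, v (T x) - v x <= C) -> 0 <= C ->
  (\int[mu]_x (C - (v (T x) - v x))%:E = C%:E)%E.
Proof.
move=> mv vab vC C0.
have mvT : measurable_fun setT (v \o T) by exact: measurableT_comp.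
have va x : 0 <= v x - a by rewrite subr_ge0; case/andP: (vab x).
have mva : measurable_fun setT (fun x => (v x - a)%:E).
  by apply/measurable_EFinP; exact: measurable_funB.
have mC : measurable_fun setT (fun x => (C - (v (T x) - v x))%:E).
  by apply/measurable_EFinP; do 2 apply: measurable_funB => //.
have fin : ((\int[mu]_x (v x - a)%:E)%E \is a fin_num).
  rewrite ge0_fin_numE; last by apply: integral_ge0 => x _; rewrite lee_fin.
  apply: (@le_lt_trans _ _ (\int[mu]_x (cst (b - a)%:E x))%E).
    apply: ge0_le_integral => //.
    - by move=> x _; rewrite lee_fin.
    - by move=> x _; rewrite lee_fin; case/andP: (vab x) => *; lra.
  by rewrite integral_cst_probability ltry.
apply: (adde_cancelr fin).
rewrite -{1}(ge0_integral_invariant mva)//.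
rewrite -ge0_integralD//; last 3 first.
- by move=> x _; rewrite lee_fin; have := vC x; lra.
- by move=> x _; rewrite lee_fin.
- exact: measurableT_comp mva mT.
have -> : (C%:E = \int[mu]_x (cst C%:E x))%E.
  by rewrite integral_cst_probability.
rewrite -ge0_integralD//; last by move=> x _; rewrite lee_fin.
by apply: eq_integral => x _ /=; rewrite -!EFinD; congr (_%:E); lra.
Qed.

(* [v] may be unbounded below and [v \o T - v] not integrable: truncate and use
   Fatou's lemma. *)
Lemma integral_coboundary_le v (b C : R) : measurable_fun setT v ->
  (forall x, v x <= b) -> (forall x, v (T x) - v x <= C) -> 0 <= C ->
  (\int[mu]_x (C - (v (T x) - v x))%:E <= C%:E)%E.
Proof.
move=> mv vb vC C0.
pose tr (n : nat) x := Num.max (v x) (- n%:R).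
have mtr n : measurable_fun setT (tr n) by exact: measurable_maxr.
(* Truncation replaces an increment by one at most the maximum of itself and [0], hence at most
   [C]. *)
have trC n x : tr n (T x) - tr n x <= C.
  have := vC x; rewrite /tr.
  by case: (leP (v (T x))) => ?; case: (leP (v x)) => ? ?; lra.
have trE n : (\int[mu]_x (C - (tr n (T x) - tr n x))%:E = C%:E)%E.
  apply: (@integral_bounded_coboundary (tr n) (- n%:R) (Num.max b 0)) => // x.
  rewrite /tr le_max lexx orbT/= ge_max !le_max vb/=.
  by apply/orP; right; have := ler0n R n; lra.
have trlim x : (C - (tr n (T x) - tr n x))%:E @[n --> \oo] -->
    (C - (v (T x) - v x))%:E.
  apply: cvg_near_cst; near=> n.
  have H (y : R) : - y <= n%:R -> Num.max y (- n%:R) = y.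
    by move=> ?; rewrite max_l//; lra.
  congr (_%:E); rewrite /tr !H//; near: n.
    exact: nbhs_infty_ger.
  exact: nbhs_infty_ger.
have -> : (\int[mu]_x (C - (v (T x) - v x))%:E =
  \int[mu]_x limn_einf (fun n => (C - (tr n (T x) - tr n x))%:E))%E.
  by apply: eq_integral => x _; rewrite (cvg_limn_einf_sup (trlim x)).1.
apply: le_trans (fatou _ _ _ _) _ => //.
- move=> n; apply/measurable_EFinP; do 2 apply: measurable_funB => //.
  exact: measurableT_comp (mtr n) mT.
- by move=> n x _; rewrite lee_fin subr_ge0.
under eq_fun do rewrite trE.
by rewrite (cvg_limn_einf_sup (cvg_cst _)).1.
Unshelve. all: by end_near. Qed.

End integrals.

(** * The skew product and its maximal invariant function *)

Section dynamics.
Context {d : measure_display} {Theta : measurableType d} {R : realType}.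
Variables (T Tinv : Theta -> Theta) (h : R -> R) (g : Theta -> R) (M : R -> R).
Hypothesis TK : cancel T Tinv.
Hypothesis TinvK : cancel Tinv T.
Hypothesis mT : measurable_fun setT T.
Hypothesis mTinv : measurable_fun setT Tinv.
Hypothesis h0 : h 0 = 0.
Hypothesis h_incr : forall x y : R, 0 <= x -> x < y -> h x < h y.
Hypothesis h_star : forall x y : R, 0 < x -> x < y -> h y * x < h x * y.
Hypothesis h_lt_id : forall x : R, 0 < x -> h x < x.
Hypothesis h_chord : h x / x @[x --> 0^'+] --> (1 : R).
Hypothesis g_gt0 : forall theta, 0 < g theta.
Hypothesis mg : measurable_fun setT g.
Hypothesis M_gt0 : forall t : R, 0 < M t.
Hypothesis M_above : forall (t : R) (theta : Theta),
  fibre_map g h t theta (M t) < M t.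

(** * Monotonicity and chord estimates for [h] and the fibre maps *)

Let h_gt0 (x : R) : 0 < x -> 0 < h x.
Proof. by move=> x0; rewrite -h0 h_incr. Qed.

Let h_ndecr (x y : R) : 0 <= x -> x <= y -> h x <= h y.
Proof.
by move=> x0; rewrite le_eqVlt => /predU1P[->//|xy]; rewrite ltW// h_incr.
Qed.

Let h_scale (c x : R) : 1 <= c -> 0 < x -> h (c * x) <= c * h x.
Proof.
move=> c1 x0; have [->|cn1] := eqVneq c 1; first by rewrite !mul1r.
have xcx : x < c * x by rewrite ltr_pMl// lt_neqAle eq_sym cn1.
by have := h_star x0 xcx; rewrite mulrA ltr_pM2r// [h x * c]mulrC => /ltW.
Qed.

(** A squeeze: [0 <= h u <= u] if [l = 0], and otherwise [h l <= h u <= (h l / l) u] because chord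
    slopes decrease. *)
Let h_cvg (u : nat -> R) l : (forall n, 0 < u n) -> (forall n, l <= u n) ->
  0 <= l -> u @ \oo --> l -> h (u n) @[n --> \oo] --> h l.
Proof.
move=> u_gt0 ul l0 u_cvg.
have [l_eq0|l_neq0] := eqVneq l 0.
  apply: (@squeeze_cvgr _ _ _ _ (cst 0) u).
  - by near=> n; rewrite /= ltW ?h_gt0// ltW// h_lt_id.
  - by rewrite l_eq0 h0; exact: cvg_cst.
  - by rewrite l_eq0 h0 -l_eq0.
have l_gt0 : 0 < l by rewrite lt_neqAle eq_sym l_neq0.
apply: (@squeeze_cvgr _ _ _ _ (cst (h l)) (fun n => h l / l * u n)).
- near=> n; rewrite /= h_ndecr//=.
  have : h (u n) * l <= h l * u n.
    have := ul n; rewrite le_eqVlt => /predU1P[<-//|/(h_star l_gt0)/ltW]; exact.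
  by rewrite mulrAC ler_pdivlMr.
- exact: cvg_cst.
- rewrite -[X in _ --> X](divfK l_neq0 (h l)); exact: cvgMl_tmp.
Unshelve. all: by end_near. Qed.

(** Only the values of [h] on the half-line are controlled, so [h] is replaced by [h (max x 0)],
    which is nondecreasing on the whole line. *)
Let measurable_h (f : Theta -> R) : measurable_fun setT f ->
  (forall x, 0 <= f x) -> measurable_fun setT (h \o f).
Proof.
move=> mf f0.
have -> : h \o f = (fun x => h (Num.max x 0)) \o f.
  by apply/funext => x /=; rewrite max_l.
apply: measurableT_comp mf.
apply: nondecreasing_measurable => // x y xy.
apply: h_ndecr; first by rewrite le_max lexx orbT.
by rewrite ge_max !le_max xy lexx orbT.
Qed.

Let fibre_map_gt0 t theta x : 0 < x -> 0 < fibre_map g h t theta x.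
Proof. by move=> x0; rewrite /fibre_map !mulr_gt0 ?expR_gt0 ?h_gt0. Qed.

Let fibre_map_le t theta x y : 0 <= x -> x <= y ->
  fibre_map g h t theta x <= fibre_map g h t theta y.
Proof.
by move=> x0 xy; rewrite /fibre_map ler_pM2l ?h_ndecr// mulr_gt0 ?expR_gt0.
Qed.

(** * Pullback iterates and their limit *)

Local Notation psi := (upper_iter T Tinv g h M).
Local Notation phi := (max_invariant T Tinv g h M).
Local Notation N := (zero_set T Tinv g h M).

(** The orbits for [n.+1] over [T theta] and for [n] over [theta] start at the same point; the one
    extra step acts over [theta]. *)
Let psiS t n theta : psi t n.+1 (T theta) = fibre_map g h t theta (psi t n theta).
Proof.
rewrite /upper_iter /= -iterS iterSr TK.
by have -> : iter n T (iter n Tinv theta) = theta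
  by elim: n => //= n IH; rewrite -iterS iterSr TinvK.
Qed.

Let psiSE t n theta :
  psi t n.+1 theta = fibre_map g h t (Tinv theta) (psi t n (Tinv theta)).
Proof. by rewrite -psiS TinvK. Qed.

Lemma upper_iter_gt0 t n theta : 0 < psi t n theta.
Proof.
elim: n theta => [|n IH] theta; first exact: M_gt0.
by rewrite psiSE fibre_map_gt0.
Qed.

Lemma upper_iter_nonincreasing t theta :
  nonincreasing_seq (fun n => psi t n theta).
Proof.
apply/nonincreasing_seqP => n.
elim: n theta => [|n IH] theta; first by rewrite psiSE; exact/ltW/M_above.
by rewrite psiSE [leRHS]psiSE fibre_map_le// ltW// upper_iter_gt0.
Qed.

Lemma upper_iter_le_M t n theta : psi t n theta <= M t.
Proof. exact: (@upper_iter_nonincreasing t theta 0 n). Qed.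

Lemma upper_iter_cvg t theta : psi t n theta @[n --> \oo] --> phi t theta.
Proof.
apply: nonincreasing_is_cvgn; first exact: upper_iter_nonincreasing.
by exists 0 => _ [n _ <-]; rewrite ltW// upper_iter_gt0.
Qed.

Lemma max_invariant_le t n theta : phi t theta <= psi t n theta.
Proof.
apply: nonincreasing_cvgn_ge; first exact: upper_iter_nonincreasing.
by apply/cvg_ex; eexists; exact: upper_iter_cvg.
Qed.

Lemma max_invariant_ge0 t theta : 0 <= phi t theta.
Proof.
apply: (cvgr_to_ge (@upper_iter_cvg t theta)).
by near=> n; rewrite ltW// upper_iter_gt0.
Unshelve. all: by end_near. Qed.

Lemma max_invariantT t theta :
  phi t (T theta) = fibre_map g h t theta (phi t theta).
Proof.
have cvg1 : psi t n.+1 (T theta) @[n --> \oo] --> phi t (T theta).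
  by rewrite (cvg_shiftS (fun n => psi t n (T theta))); exact: upper_iter_cvg.
have cvg2 : psi t n.+1 (T theta) @[n --> \oo] -->
    fibre_map g h t theta (phi t theta).
  under eq_fun do rewrite psiS.
  apply: cvgMl_tmp; apply: h_cvg.
  - by move=> n; exact: upper_iter_gt0.
  - by move=> n; exact: max_invariant_le.
  - exact: max_invariant_ge0.
  - exact: upper_iter_cvg.
by apply: (@cvg_unique _ (@norm_hausdorff _ R) _ _ _ _ cvg1 cvg2).
Qed.

Lemma measurable_upper_iter t n : measurable_fun setT (psi t n).
Proof.
elim: n => [|n IH]; first exact: measurable_cst.
have -> : psi t n.+1 =
    (fun theta => fibre_map g h t theta (psi t n theta)) \o Tinv.
  by apply/funext => theta /=; rewrite psiSE.
apply: measurableT_comp mTinv; apply: measurable_funM.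
  exact: measurable_funM.
by apply: measurable_h => // theta; rewrite ltW// upper_iter_gt0.
Qed.

Lemma measurable_max_invariant t : measurable_fun setT (phi t).
Proof.
apply: (measurable_fun_cvg (@measurable_upper_iter t)) => theta _.
exact: upper_iter_cvg.
Qed.

(** * Zero sets and critical sets *)

Lemma measurable_zero_set t : measurable (N t).
Proof.
have -> : N t = setT `&` phi t @^-1` [set 0] by rewrite setTI.
by apply: measurable_max_invariant.
Qed.

Lemma zero_set_invariant t : T @^-1` N t = N t.
Proof.
apply/seteqP; split=> theta; rewrite /zero_set /= max_invariantT /fibre_map.
  move=> /eqP; rewrite mulf_eq0 gt_eqF ?mulr_gt0 ?expR_gt0//= => /eqP hphi.
  apply/eqP; rewrite eq_le max_invariant_ge0 andbT leNgt; apply/negP => /h_gt0.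
  by rewrite hphi ltxx.
by move=> ->; rewrite h0 mulr0.
Qed.

(* [M] is arbitrary, so that the iterates for two parameters start at unrelated
   points; by concavity the ratio of the starting points is not amplified. *)
Lemma zero_set_le t s : t <= s -> N t `<=` N s.
Proof.
move=> ts theta; rewrite /zero_set /= => phi0.
(* The ratio [M s / M t] starts the induction; [c >= 1] is what [h (c * x) <= c * h x] requires. *)
pose c := Num.max 1 (M s / M t).
have c1 : 1 <= c by rewrite le_max lexx.
have psi_le n x : psi s n x <= c * psi t n x.
  elim: n x => [|n IH] x.
    by rewrite -ler_pdivrMr ?M_gt0// le_max lexx orbT.
  rewrite !psiSE /fibre_map.
  set y := Tinv x; rewrite mulrCA.
  apply: ler_pM.
  - by rewrite mulr_ge0 ?expR_ge0 ?ltW.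
  - by rewrite ltW// h_gt0// upper_iter_gt0.
  - by rewrite ler_pM2r// ler_expR lerN2.
  - apply: le_trans (h_scale c1 (upper_iter_gt0 t n y)).
    by apply: h_ndecr => //; rewrite ltW// upper_iter_gt0.
apply/eqP; rewrite eq_le max_invariant_ge0 andbT.
rewrite -(mulr0 c) -phi0.
apply: (@ler_cvg_to _ _ _ _ _ _ _ _ (@upper_iter_cvg s theta)
  (cvgMl_tmp (@upper_iter_cvg t theta))).
by near=> n.
Unshelve. all: by end_near. Qed.

Lemma critical_set_sub t s : t < s ->
  critical_set T Tinv g h M t `<=` N s.
Proof.
move=> ts theta; rewrite /critical_set /critical_parameter /= => tE.
have : (ereal_inf [set r%:E | r in [set r | phi r theta = 0%R]] < s%:E)%E.
  by rewrite tE lte_fin.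
move=> /ereal_inf_lt[_ [r /= rN <-]]; rewrite lte_fin => /ltW rs.
exact: zero_set_le rs _ rN.
Qed.

Lemma critical_set_subC t s : s < t ->
  critical_set T Tinv g h M t `<=` ~` N s.
Proof.
move=> st theta; rewrite /critical_set /critical_parameter /= => tE sN.
have : (ereal_inf [set r%:E | r in [set r | phi r theta = 0%R]] <= s%:E)%E.
  by apply: ereal_inf_lbound; exists s.
by rewrite tE lee_fin leNgt st.
Qed.

(** Monotonicity of [N] in the parameter reduces the infimum to countably many parameters, which
    gives measurability and allows countable unions of null sets. *)
Lemma critical_setE t : critical_set T Tinv g h M t =
  (\bigcap_n N (t + n.+1%:R^-1)) `\` (\bigcup_n N (t - n.+1%:R^-1)).
Proof.
apply/seteqP; split => theta.
  move=> tS; split=> [n _|[n _ tN]].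
    by apply: critical_set_sub tS; rewrite ltrDl invr_gt0.
  by apply: (critical_set_subC _ tS tN); rewrite ltrBlDr ltrDl invr_gt0.
have eps (e : R) : 0 < e -> exists n, n.+1%:R^-1 < e.
  move=> e0; exists (Num.truncn e^-1); rewrite invf_plt ?posrE//.
  exact: truncnS_gt.
rewrite /critical_set /critical_parameter /=.
move=> [tN tnN]; apply/eqP; rewrite eq_le; apply/andP; split.
  apply/lee_addgt0Pr => e /eps[n ne].
  apply: (@le_trans _ _ (t + n.+1%:R^-1)%:E).
    by apply: ereal_inf_lbound; exists (t + n.+1%:R^-1) => //; exact: tN.
  by rewrite -EFinD lee_fin lerD2l ltW.
apply: le_ereal_inf_tmp => _ [r /= rN <-]; rewrite lee_fin leNgt.
apply/negP => rt; apply: tnN.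
have [|n ne] := eps (t - r); first by rewrite subr_gt0.
by exists n => //; apply: zero_set_le rN; rewrite lerBrDl -lerBrDr ltW.
Qed.

(** * The integral of the defect [C - w] *)

Variable mu : probability Theta R.
Hypothesis mu_inv : invariant_measure T mu.
Variables (t C : R).
Hypothesis C0 : 0 <= C.
Local Notation w theta := (ln (expR (- t) * g theta)).
Hypothesis wC : forall theta, w theta <= C.

Let a_gt0 theta : 0 < expR (- t) * g theta.
Proof. by rewrite mulr_gt0 ?expR_gt0. Qed.

Let mw : measurable_fun setT (fun theta => w theta).
Proof. by apply: measurableT_comp; [exact: measurable_ln|exact: measurable_funM]. Qed.

Let ln_fibre_map theta x : 0 < x ->
  ln (fibre_map g h t theta x) = w theta + ln (h x).
Proof. by move=> x0; rewrite /fibre_map lnM// posrE ?h_gt0. Qed.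

(* With [v := ln phi], the invariance of [phi] reads
   [w = (v \o T - v) + ln (phi / h phi)] off [N t], and [phi / h phi > 1]. *)
Lemma integral_defect_lt :
  mu (N t) = 0%E -> (\int[mu]_x (C - w x)%:E < C%:E)%E.
Proof.
move=> muN.
pose v theta := ln (phi t theta).
pose k theta := v theta - ln (h (phi t theta)).
have phi_ge0 := max_invariant_ge0 t.
have mv : measurable_fun setT v.
  by apply: measurableT_comp; [exact: measurable_ln|exact: measurable_max_invariant].
have mk : measurable_fun setT k.
  apply: measurable_funB => //; apply: measurableT_comp; first exact: measurable_ln.
  by apply: measurable_h => //; exact: measurable_max_invariant.
have k_gt0 theta : 0 < phi t theta -> 0 < k theta.
  by move=> p0; rewrite subr_gt0 ltr_ln ?posrE ?h_lt_id ?h_gt0.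
have phi_cases theta : phi t theta = 0 \/ 0 < phi t theta.
  by have := phi_ge0 theta; rewrite le_eqVlt => /predU1P[|]; [left|right].
(* Where [phi] vanishes, both logarithms in [k] are [ln 0], as [h 0 = 0], and they cancel. *)
have k_ge0 theta : 0 <= k theta.
  case: (phi_cases theta) => [p0|/k_gt0/ltW//].
  by rewrite /k /v p0 h0 subrr.
have vTE theta : 0 < phi t theta -> v (T theta) - v theta = w theta - k theta.
  by move=> p0; rewrite /v max_invariantT ln_fibre_map// /k /v; lra.
have vC theta : v (T theta) - v theta <= C.
  case: (phi_cases theta) => [p0|p0].
    by rewrite /v max_invariantT /fibre_map p0 h0 mulr0 subrr.
  by rewrite vTE//; have := k_ge0 theta; have := wC theta; lra.
(* The maximum with [0] covers the points where [phi = 0], by the convention [ln 0 = 0]. *)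
have v_le theta : v theta <= Num.max (ln (M t)) 0.
  rewrite le_max; case: (phi_cases theta) => [p0|p0].
    by rewrite /v p0 ln0 ?lexx ?orbT.
  by rewrite ler_ln ?posrE// (max_invariant_le t 0).
have mCw : measurable_fun setT (fun x => (C - w x)%:E).
  by apply/measurable_EFinP; exact: measurable_funB.
have mCv : measurable_fun setT (fun x => (C - (v (T x) - v x))%:E).
  apply/measurable_EFinP; do 2 apply: measurable_funB => //.
  exact: measurableT_comp mv mT.
have mEk : measurable_fun setT (fun x => (k x)%:E) by exact/measurable_EFinP.
have := integral_coboundary_le mT mu_inv mv v_le vC C0.
have -> : (\int[mu]_x (C - (v (T x) - v x))%:E =
    \int[mu]_x (C - w x)%:E + \int[mu]_x (k x)%:E)%E.
  rewrite -ge0_integralD//; last 2 first.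
  - by move=> x _; rewrite lee_fin subr_ge0.
  - by move=> x _; rewrite lee_fin.
  apply: ge0_ae_eq_integral => //.
  - exact: emeasurable_funD.
  - by move=> x _; rewrite lee_fin subr_ge0.
  - by move=> x _; rewrite -EFinD lee_fin addr_ge0// subr_ge0.
  - exists (N t); split => //; first exact: measurable_zero_set.
    move=> x /= /not_implyP[_ neq]; case: (phi_cases x) => // p0.
    by exfalso; apply: neq; rewrite vTE// -EFinD; congr EFin; lra.
(* If the integral vanished, [k] would be zero off a null set [Z]; as [k > 0] off [N t], the null
   sets [N t] and [Z] would cover the whole space. *)
have k_int : (0 < \int[mu]_x (k x)%:E)%E.
  rewrite lt0e integral_ge0 ?andbT; last by move=> x _; rewrite lee_fin.
  apply/negP => /eqP k0.
  have /(ae_eq_integral_abs mu measurableT mEk) [Z [mZ muZ subZ]] :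
      (\int[mu]_x `|(k x)%:E| = 0)%E.
    by rewrite -k0; apply: eq_integral => x _; rewrite gee0_abs// lee_fin.
  have NZ : N t `|` Z = setT.
    apply/seteqP; split => // x _.
    case: (phi_cases x) => [p0|/k_gt0 kx]; [by left|right].
    by apply: subZ => /= /(_ I) [kx0]; move: kx; rewrite kx0 ltxx.
  have : mu setT = 0%E.
    by rewrite -NZ; apply: null_set_setU => //; exact: measurable_zero_set.
  by move/eqP; rewrite probability_setT onee_eq0.
move: k_int.
by move: (\int[mu]_x (C - w x)%:E)%E (\int[mu]_x (k x)%:E)%E => [l||] [q||];
  rewrite -?EFinD ?lee_fin ?lte_fin ?ltNyr//; lra.
Qed.

(* With [u_n := ln M - ln psi_n] and [k_n := ln (psi_n / h psi_n)] the recursion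
   reads [u_(n+1) \o T + C = u_n + (C - w) + k_n], where [u_n] increases with [n],
   and [k_n] tends to [0] on [N t]. *)
Lemma integral_defect_ge :
  mu (N t) = 1%E -> (C%:E <= \int[mu]_x (C - w x)%:E)%E.
Proof.
move=> muN.
pose u n theta := ln (M t) - ln (psi t n theta).
pose k n theta := ln (psi t n theta) - ln (h (psi t n theta)).
have psi_gt0 := upper_iter_gt0 t.
have mlnpsi n : measurable_fun setT (fun theta => ln (psi t n theta)).
  by apply: measurableT_comp; [exact: measurable_ln|exact: measurable_upper_iter].
have mu_ n : measurable_fun setT (u n) by exact: measurable_funB.
have mk n : measurable_fun setT (k n).
  apply: measurable_funB => //; apply: measurableT_comp; first exact: measurable_ln.
  by apply: measurable_h => [|x]; [exact: measurable_upper_iter|exact: ltW].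
have u_ge0 n theta : 0 <= u n theta.
  by rewrite subr_ge0 ler_ln ?posrE// upper_iter_le_M.
have u_ndecr n theta : u n theta <= u n.+1 theta.
  by rewrite lerD2l lerN2 ler_ln ?posrE//; exact: upper_iter_nonincreasing.
have k_ge0 n theta : 0 <= k n theta.
  by rewrite subr_ge0 ler_ln ?posrE ?h_gt0// ltW// h_lt_id.
(* Since [psi <= M], decreasing chord slopes give [psi / h psi <= M / h M]: a constant bound for
   dominated convergence. *)
have k_le n theta : k n theta <= ln (M t) - ln (h (M t)).
  have := upper_iter_le_M t n theta; rewrite le_eqVlt => /predU1P[e|psi_lt].
    by rewrite /k e.
  rewrite lerBlDr addrAC lerBrDr -!lnM ?posrE ?h_gt0//.
  rewrite ler_ln ?posrE ?mulr_gt0 ?h_gt0//.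
  by have := h_star (psi_gt0 n theta) psi_lt; nra.
have recur n theta :
    u n.+1 (T theta) + C = u n theta + ((C - w theta) + k n theta).
  by rewrite /u /k psiS ln_fibre_map//; lra.
have mEu n : measurable_fun setT (fun x => (u n x)%:E) by exact/measurable_EFinP.
have mEk n : measurable_fun setT (fun x => (k n x)%:E) by exact/measurable_EFinP.
have mCw : measurable_fun setT (fun x => (C - w x)%:E).
  by apply/measurable_EFinP; exact: measurable_funB.
set L := (\int[mu]_x (C - w x)%:E)%E.
(* If [L] is infinite the claim is trivial; otherwise every integral in the recursion is finite,
   starting from [u 0 = 0], and can be cancelled. *)
have [Lfin|] := boolP (L \is a fin_num); last first.
  rewrite ge0_fin_numE; last first.
    by apply: integral_ge0 => x _; rewrite lee_fin subr_ge0.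
  by rewrite -leNgt leye_eq => /eqP ->; rewrite leey.
have kfin n : (\int[mu]_x (k n x)%:E)%E \is a fin_num.
  rewrite ge0_fin_numE; last by apply: integral_ge0 => x _; rewrite lee_fin.
  apply: (@le_lt_trans _ _ (\int[mu]_x (cst (ln (M t) - ln (h (M t)))%:E x))%E).
    by apply: ge0_le_integral => // x _; rewrite lee_fin.
  by rewrite integral_cst_probability ltry.
have int_recur n : (\int[mu]_x (u n.+1 x)%:E + C%:E =
    \int[mu]_x (u n x)%:E + (L + \int[mu]_x (k n x)%:E))%E.
  rewrite -(ge0_integral_invariant mT mu_inv (mEu n.+1)); last first.
    by move=> x; rewrite lee_fin.
  rewrite -[X in (_ + X = _)%E](integral_cst_probability mu).
  rewrite -!ge0_integralD//.
  - by apply: eq_integral => x _; rewrite -!EFinD recur.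
  - by move=> x _; rewrite lee_fin.
  - by move=> x _; rewrite -EFinD lee_fin addr_ge0// subr_ge0.
  - exact: emeasurable_funD.
  - by move=> x _; rewrite lee_fin subr_ge0.
  - by move=> x _; rewrite lee_fin.
  - by move=> x _; rewrite lee_fin.
  - exact: measurableT_comp (mEu n.+1) mT.
have ufin n : (\int[mu]_x (u n x)%:E)%E \is a fin_num.
  elim: n => [|n IH].
    rewrite (_ : (fun x => _) = cst 0%E) ?integral0//.
    by apply/funext => x; rewrite /u subrr.
  have : (\int[mu]_x (u n.+1 x)%:E + C%:E)%E \is a fin_num.
    by rewrite int_recur fin_numD IH fin_numD Lfin kfin.
  by rewrite fin_numD => /andP[].
(* Cancel the integral of [u n] in the integrated recursion, using that it is at most that of
   [u n.+1]. *)
have C_le n : (C%:E <= L + \int[mu]_x (k n x)%:E)%E.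
  rewrite -(leeD2lE (x := (\int[mu]_x (u n x)%:E)%E))// -int_recur leeD2r//.
  by apply: ge0_le_integral => // x _; rewrite lee_fin.
have k_cvg theta : N t theta -> (k n theta)%:E @[n --> \oo] --> 0%E.
  move=> theta0; apply: cvg_EFin; first by near=> n.
  have psi_cvg : psi t n theta @[n --> \oo] --> 0^'+.
    have := @upper_iter_cvg t theta; rewrite theta0 => psi0 P.
    rewrite /at_right /within /= => /psi0; apply: (@filterS _ \oo) => n /=; apply.
    exact: psi_gt0.
  have : ln (h (psi t n theta) / psi t n theta) @[n --> \oo] --> ln (1 : R).
    apply: continuous_cvg; first exact: continuous_ln.
    exact: cvg_comp psi_cvg h_chord.
  rewrite ln1 => /cvgN; rewrite oppr0; apply: cvg_trans; apply: near_eq_cvg.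
  by near=> n; rewrite /k opprfctE /= ln_div ?posrE ?h_gt0// opprB.
pose K := ln (M t) - ln (h (M t)).
have k_ae : {ae mu, forall x, setT x -> (k n x)%:E @[n --> \oo] --> cst 0%E x}.
  exists (~` N t); split; first exact/measurableC/measurable_zero_set.
    by rewrite probability_setC ?muN ?subee//; exact: measurable_zero_set.
  by move=> x /=; apply: contra_not => Nx _; exact: k_cvg.
have K_int : mu.-integrable setT (cst K%:E) by exact: finite_measure_integrable_cst.
have k_dom : {ae mu, forall x n, setT x -> (`|(k n x)%:E| <= cst K%:E x)%E}.
  by apply/aeW => x n _; rewrite gee0_abs ?lee_fin.
have [_ _ int_cvg] := dominated_convergence measurableT mEk
  (measurable_cst 0%E) k_ae K_int k_dom.
rewrite integral0 in int_cvg.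
have Lcvg : (L + \int[mu]_x (k n x)%:E)%E @[n --> \oo] --> (L + 0)%E.
  by apply: cvgeD => //; [rewrite fin_num_adde_defl|exact: cvg_cst].
rewrite -[leRHS]adde0 -(cvg_lim _ Lcvg)//.
apply: lime_ge; first by apply/cvg_ex; eexists; exact: Lcvg.
by near=> n.
Unshelve. all: by end_near. Qed.

End dynamics.

(** * Lyapunov exponents at the baseline *)

Section baseline.
Context {d : measure_display} {Theta : measurableType d} {R : realType}.
Variables (mu : probability Theta R) (g : Theta -> R).
Hypothesis g_gt0 : forall theta, 0 < g theta.
Hypothesis mg : measurable_fun setT g.

(** The condition [0 <= C + t] is there because [C + t] serves as the upper bound of [ln g] when [C]
    bounds [ln (e^-t g)]. *)
Lemma ln_scaled_bounded t (B : R) : (forall theta, g theta <= B) ->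
  exists C : R, [/\ 0 <= C, 0 <= C + t &
    forall theta, ln (expR (- t) * g theta) <= C].
Proof.
move=> gB; exists (`|t| + `|ln B|).
have := ler_norm (- t); have := normr_ge0 (ln B); rewrite normrN => lnB0 tt.
split=> [||theta]; [by rewrite addr_ge0|lra|].
rewrite lnM ?posrE ?expR_gt0// expRK lerD//.
apply: le_trans (ler_norm _); rewrite ler_ln ?posrE//.
exact: lt_le_trans (gB theta).
Qed.

(** Both sides are expressed through the same nonnegative defect [C - ln (e^-t g) = (C + t) - ln g],
    which also covers the value [-oo]. *)
Lemma integral_ln_scaled t (B : R) : (forall theta, g theta <= B) ->
  (\int[mu]_x (ln (expR (- t) * g x))%:E = mean_log g mu - t%:E)%E.
Proof.
move=> /(@ln_scaled_bounded t)[C [C0 Ct0 gC]].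
have lnE x : ln (expR (- t) * g x) = ln (g x) - t.
  by rewrite lnM ?posrE ?expR_gt0// expRK addrC.
have mlng : measurable_fun setT (fun x => ln (g x)).
  by apply: measurableT_comp; [exact: measurable_ln|].
have mw : measurable_fun setT (fun x => ln (expR (- t) * g x)).
  by apply: measurableT_comp; [exact: measurable_ln|exact: measurable_funM].
rewrite (integral_bounded_above mu mw C0 gC) /mean_log.
rewrite (integral_bounded_above mu mlng Ct0); last first.
  by move=> x; have := gC x; rewrite lnE; lra.
have -> : (\int[mu]_x (C + t - ln (g x))%:E =
    \int[mu]_x (C - ln (expR (- t) * g x))%:E)%E.
  by apply: eq_integral => x _; rewrite lnE; congr EFin; lra.
case: (\int[mu]_x _)%E => [r||]//; rewrite -!EFinD; congr EFin; lra.
Qed.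

Lemma baseline_exponentE h t : C1_nneg h -> derive_nneg h 0 = 1 ->
  baseline_exponent g h t mu = (\int[mu]_x (ln (expR (- t) * g x))%:E)%E.
Proof.
move=> h_C1 dh0; apply: eq_integral => x _.
rewrite /fibre_map derive_nnegZ// ?dh0 ?mulr1; last exact: h_C1.1.
by rewrite gtr0_norm// mulr_gt0 ?expR_gt0.
Qed.

End baseline.

(** * The sign of the baseline exponent and the measure of the zero set *)

Unset Implicit Arguments.

Theorem corollary2 (R : realType) (d : measure_display)
    (Theta : measurableType d) (T Tinv : Theta -> Theta)
    (TK : cancel T Tinv) (TinvK : cancel Tinv T)
    (mT : measurable_fun [set: Theta] T)
    (mTinv : measurable_fun [set: Theta] Tinv)
    (h : R -> R)
    (h_C1 : C1_nneg h)
    (h_concave : strictly_concave_nneg h)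
    (h0 : h 0 = 0)
    (dh_gt0 : forall x : R, 0 < x -> 0 < derive_nneg h x)
    (dh0 : derive_nneg h 0 = 1)
    (h_sublinear : h x / x @[x --> +oo] --> 0)
    (g : Theta -> R)
    (g_gt0 : forall theta, 0 < g theta)
    (g_bounded : exists C : R, forall theta, g theta <= C)
    (mg : measurable_fun [set: Theta] g)
    (M : R -> R)
    (M_gt0 : forall t : R, 0 < M t)
    (M_above : forall (t : R) (theta : Theta),
      fibre_map g h t theta (M t) < M t)
    (mu : probability Theta R) (mu_inv : invariant_measure T mu) (t : R) :
  let N := zero_set T Tinv g h M t in
  let S := critical_set T Tinv g h M t in
  let gamma := mean_log g mu in
  let gamma_t := baseline_exponent g h t mu in
  ((0 < gamma_t)%E <-> (t%:E < gamma)%E) /\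
  ((gamma_t <= 0)%E <-> (gamma <= t%:E)%E) /\
  (mu N = 0%E -> (0 < gamma_t)%E) /\
  (mu N = 1%E -> (gamma_t <= 0)%E) /\
  (ergodic T mu ->
    (mu N = 0%E <-> (0 < gamma_t)%E) /\
    (mu N = 1%E <-> (gamma_t <= 0)%E) /\
    (t%:E = gamma -> mu S = 1%E) /\
    (t%:E <> gamma -> mu S = 0%E)).
Proof.
move=> N S gamma gamma_t.
have h_incr x y : 0 <= x -> x < y -> h x < h y.
  by move=> x0; exact: (concave_increasing h_C1 h_concave dh_gt0 x0).
have h_star := concave_star h_concave h0.
have h_lt_id x := concave_lt_id h_C1 h_concave h0 (x := x) dh0.
have h_chord := concave_chord_cvg h_C1 h0 dh0.
have [B gB] := g_bounded.
pose Ns s := zero_set T Tinv g h M s.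
have mN s : measurable (Ns s).
  by apply: measurable_zero_set.
have base s : baseline_exponent g h s mu = (gamma - s%:E)%E.
  by rewrite baseline_exponentE// (integral_ln_scaled _ g_gt0 mg _ gB).
have mln s : measurable_fun setT (fun x => ln (expR (- s) * g x)).
  by apply: measurableT_comp; [exact: measurable_ln|exact: measurable_funM].
have N0 s : mu (Ns s) = 0%E -> (s%:E < gamma)%E.
  move=> muN; have [C [C0 _ wC]] := ln_scaled_bounded g_gt0 s gB.
  rewrite -sube_gt0 -base baseline_exponentE// (integral_bounded_above _ _ C0)//.
  rewrite sube_gt0.
  exact: (integral_defect_lt TK TinvK mT mTinv h0 h_incr h_star h_lt_id g_gt0 mg
    M_gt0 M_above mu_inv C0 wC muN).
have N1 s : mu (Ns s) = 1%E -> (gamma <= s%:E)%E.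
  move=> muN; have [C [C0 _ wC]] := ln_scaled_bounded g_gt0 s gB.
  rewrite -sube_le0 -base baseline_exponentE// (integral_bounded_above _ _ C0)//.
  rewrite sube_le0.
  exact: (integral_defect_ge TK TinvK mT mTinv h0 h_incr h_star h_lt_id h_chord g_gt0
    mg M_gt0 M_above mu_inv C0 wC muN).
have gt0E : (0 < gamma_t)%E = (t%:E < gamma)%E by rewrite /gamma_t base sube_gt0.
have le0E : (gamma_t <= 0)%E = (gamma <= t%:E)%E by rewrite /gamma_t base sube_le0.
rewrite gt0E le0E; do 4 (split; first by [|exact: N0|exact: N1]).
move=> mu_erg.
have N01 s : mu (Ns s) = 0%E \/ mu (Ns s) = 1%E.
  apply: mu_erg => //.
  by apply: zero_set_invariant.
(* By the zero-one alternative, each converse is the contrapositive of the other implication. *)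
have N0E s : (s%:E < gamma)%E -> mu (Ns s) = 0%E.
  by move=> sg; case: (N01 s) => // /N1; rewrite leNgt sg.
have N1E s : (gamma <= s%:E)%E -> mu (Ns s) = 1%E.
  by move=> sg; case: (N01 s) => // /N0; rewrite ltNge sg.
split; first by split; [exact: N0|exact: N0E].
split; first by split; [exact: N1|exact: N1E].
have SE : S = (\bigcap_n Ns (t + n.+1%:R^-1)) `\` (\bigcup_n Ns (t - n.+1%:R^-1)).
  apply: critical_setE; eassumption.
have mS : measurable S.
  by rewrite SE; apply: measurableD;
    [exact: bigcapT_measurable|exact: bigcup_measurable].
split=> [tgamma|tgamma].
  have null s : mu (Ns s) = 0%E -> mu.-negligible (Ns s).
    by move=> ?; exists (Ns s); split.
  have nullC s : mu (Ns s) = 1%E -> mu.-negligible (~` Ns s).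
    move=> muN; exists (~` Ns s); split => //; first exact: measurableC.
    by rewrite probability_setC// muN subee.
  (* For [t = gamma], [N_s] is null when [s < t] and of full measure when [s > t], so the complement
     of [S] is a countable union of null sets. *)
  have : mu (~` S) = 0%E.
    apply: measure_negligible; first exact: measurableC.
    rewrite SE setDE setCI setCK setC_bigcap; apply: negligibleU.
      apply: negligible_bigcup => n; apply/nullC/N1E.
      by rewrite -tgamma lee_fin lerDl.
    apply: negligible_bigcup => n; apply/null/N0E.
    by rewrite -tgamma lte_fin ltrBlDr ltrDl invr_gt0.
  by move=> muSC; rewrite -[S]setCK probability_setC ?muSC ?sube0//; exact: measurableC.
(* A parameter [s] between [t] and [gamma] traps [S] in a null set: [N_s] if [t < gamma], its
   complement if [gamma < t]. Infinite [gamma] is handled by [t + 1] or [t - 1]. *)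
have [tg|gt] := ltP t%:E gamma.
  have [s ts sg] : exists2 s, t < s & (s%:E < gamma)%E.
    case: gamma tg {tgamma base N0 N1 gt0E le0E N0E N1E} => [r||]//.
    - by rewrite lte_fin => tr; exists ((t + r) / 2); rewrite ?lte_fin; lra.
    - by move=> _; exists (t + 1); rewrite ?ltry; lra.
  apply: (@subset_measure0 _ _ _ mu S (Ns s)) => //; last exact: N0E.
  exact: critical_set_sub ts.
have [s st gs] : exists2 s, s < t & (gamma <= s%:E)%E.
  have : (gamma < t%:E)%E by rewrite lt_neqAle gt andbT; apply/eqP => /esym.
  case: gamma {tgamma base N0 N1 gt0E le0E N0E N1E gt} => [r||]//.
  - by rewrite lte_fin => tr; exists ((t + r) / 2); rewrite ?lee_fin; lra.
  - by move=> _; exists (t - 1); rewrite ?leNye; lra.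
have Nc0 : mu (~` Ns s) = 0%E by rewrite probability_setC// N1E// subee.
apply: (@subset_measure0 _ _ _ mu S (~` Ns s)) => //; first exact: measurableC.
exact: critical_set_subC st.
Qed.
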